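(* Let $X\neq\{0\}$ be a Banach space over $\mathbb{F}$ ($\mathbb{F}=\mathbb{R}$ or $\mathbb{C}$). Then the following statements are equivalent: (a) $n(X)=1$. (b) $B_{L(X)^*}=\overline{\operatorname{co}}^{\,weak^*}\{x^*\otimes x: x^*\in E_{B_{X^*}},\ x\in S_X,\ |x^*(x)|=1\}$. (c) For every $f\in E_{B_{L(X)^*}}$ there exists a net $\{x_\beta^*\otimes x_\beta\}_{\beta\in\Lambda}$, where $x_\beta^*\in E_{B_{X^*}}$, $x_\beta\in S_X$ and $|x_\beta^*(x_\beta)|=1$ for every $\beta$, such that $x_\beta^*\otimes x_\beta\to f$ in the weak* topology of $L(X)^*$. (d) For every $f\in E_{B_{L(X)^*}}$ there exists a net $\{x_\beta^*\otimes x_\beta\}_{\beta\in\Lambda}$, where $x_\beta^*\in S_{X^*}$, $x_\beta\in S_X$ and $|x_\beta^*(x_\beta)|=1$ for every $\beta$, such that $x_\beta^*\otimes x_\beta\to f$ in the weak* topology of $L(X)^*$.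
   Context: For a Banach (or normed) space $Z$ over $\mathbb{F}$, $B_Z$ and $S_Z$ denote the closed unit ball and unit sphere, $Z^*$ the topological dual, and $E_C$ the set of extreme points of a convex set $C$. $L(X)$ is the Banach space of bounded linear operators $X\to X$ with the usual operator norm, and $L(X)^*$ is its dual. For $T\in L(X)$ the numerical radius is $w(T)=\sup\{|x^*(Tx)|: x^*\in S_{X^*}, x\in S_X, x^*(x)=1\}$, and the numerical index of $X$ is $n(X)=\inf\{w(T): T\in L(X), \|T\|=1\}$; thus $n(X)=1$ iff $w(T)=\|T\|$ for all $T\in L(X)$. For $x\in X$, $x^*\in X^*$, $x^*\otimes x$ denotes the linear functional on $L(X)$ given by $[x^*\otimes x](T)=x^*(Tx)$. $\overline{\operatorname{co}}^{\,weak^*}(M)$ is the weak*-closed convex hull of $M$; the weak* topology on $L(X)^*$ is that of pointwise convergence on $L(X)$. *)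

(* Defs.v *)
From HB Require Import structures.
From mathcomp Require Import all_boot all_order all_algebra.
From mathcomp Require Import complex.
From mathcomp Require Import all_classical all_reals all_analysis.

Set Implicit Arguments.
Unset Strict Implicit.
Unset Printing Implicit Defensive.

Import Order.TTheory GRing.Theory Num.Theory.
Import numFieldNormedType.Exports.

Local Open Scope classical_set_scope.
Local Open Scope ring_scope.

Variant field_kind := RealScalars | ComplexScalars.

(* The norms of a normed module over [scalar_field R ComplexScalars] take their
   values in R[i]; its order relates only numbers with the same imaginary
   part, so that it restricts to the usual order of R, and a least upper or
   greatest lower bound (in R[i]) of a nonempty set of real numbers is a least
   upper or greatest lower bound in R. *)
Definition scalar_field (R : realType) (k : field_kind) : numFieldType :=
  match k with
  | RealScalars => R
  | ComplexScalars => R[i]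
  end.

Lemma scalar_supremums (R : realType) (k : field_kind)
    (A : set (scalar_field R k)) :
  A !=set0 -> (forall a, A a -> 0 <= a) -> ubound A !=set0 ->
  supremums A !=set0.
Proof.
case: k A => /= A [a0 Aa0] A_ge0 [u Au].
  exists (sup A : R); split => [a Aa | v Av].
    by apply: ub_le_sup => //; exists u.
  by apply: ge_sup => //; exists a0.
have ReE (a : R[i]) : A a -> a = (complex.Re a)%:C%C.
  by move=> /A_ge0; case: a => a b; rewrite lecE /= => /andP[/eqP -> _].
have A0 : [set complex.Re a | a in A] !=set0 by exists (complex.Re a0), a0.
have ReA (v : R[i]) : ubound A v ->
    [/\ ubound [set complex.Re a | a in A] (complex.Re v)
      & complex.Im v = 0].
  move=> Av; split.
    by move=> _ [a Aa <-]; have := Av _ Aa; rewrite lecE => /andP[].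
  by have := le_trans (A_ge0 _ Aa0) (Av _ Aa0); rewrite lecE => /andP[/eqP].
exists ((sup [set complex.Re a | a in A])%:C%C : R[i]); split.
  move=> a Aa; rewrite (ReE a Aa) lecR; apply: ub_le_sup; last by exists a.
  by exists (complex.Re u); have [] := ReA _ Au.
move=> v Av; have [vub v0] := ReA _ Av.
by rewrite lecE /= v0 eqxx /=; apply: ge_sup.
Qed.

Section bounded_operators.
Context {R : realType} {k : field_kind}.
Local Notation K := (scalar_field R k).
Implicit Types V W : normedModType K.

Definition is_boundedop V W : {pred V -> W} :=
  fun f => `[< linear f /\ exists M : K, forall x, `|f x| <= M * `|x| >].

Record boundedop V W := BoundedOp {
  boundedop_fun :> V -> W ;
  _ : boundedop_fun \in @is_boundedop V W }.

End bounded_operators.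

Arguments is_boundedop {R k V W}.

Section bounded_operators_lmodule.
Context {R : realType} {k : field_kind}.
Local Notation K := (scalar_field R k).
Variables V W : normedModType K.

Lemma is_boundedopP (f : V -> W) : reflect
  (linear f /\ exists M : K, forall x, `|f x| <= M * `|x|)
  (f \in @is_boundedop R k V W).
Proof. exact: asboolP. Qed.

Lemma is_boundedop_submod_closed : submod_closed (@is_boundedop R k V W).
Proof.
split=> [|a f g /is_boundedopP[lf [M fM]] /is_boundedopP[lg [N gN]]].
  apply/is_boundedopP; split=> [a x y|]; first by rewrite /= scaler0 addr0.
  by exists 0 => x; rewrite normr0 mul0r.
apply/is_boundedopP; split=> [b x y|].
  rewrite !fctE /= lf lg !scalerDr !scalerA [b * a]mulrC.
  by rewrite addrACA.
exists (`|a| * M + N) => x; rewrite !fctE (le_trans (ler_normD _ _))//.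
by rewrite mulrDl lerD// normrZ -mulrA ler_wpM2l.
Qed.

HB.instance Definition _ :=
  GRing.isSubmodClosed.Build K (V -> W) (@is_boundedop R k V W)
    is_boundedop_submod_closed.

HB.instance Definition _ := [isSub for @boundedop_fun R k V W].
HB.instance Definition _ := [Choice of boundedop V W by <:].
HB.instance Definition _ := [SubChoice_isSubLmodule of boundedop V W by <:].

Lemma boundedop_linear (f : boundedop V W) : linear f.
Proof. by case/is_boundedopP: (valP f). Qed.

HB.instance Definition _ (f : boundedop V W) :=
  GRing.isLinear.Build K V W *:%R (boundedop_fun f) (boundedop_linear f).

Lemma boundedop_bounded (f : boundedop V W) :
  exists2 M : K, 0 <= M & forall x, `|f x| <= M * `|x|.
Proof.
have /is_boundedopP[_ [M fM]] := valP f; exists `|M| => // x.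
by rewrite -[X in _ * X]normr_id -normrM (le_trans (fM x))//
  real_ler_norm// ger0_real// (le_trans _ (fM x)).
Qed.

Lemma boundedop_continuous (f : boundedop V W) : continuous f.
Proof.
have [M M0 fM] := boundedop_bounded f.
apply: (@bounded_linear_continuous _ _ _ f); apply/linear_boundedP.
near=> r => x; rewrite (le_trans (fM x))// ler_wpM2r//.
by near: r; apply: nbhs_pinfty_ge; exact: ger0_real.
Unshelve. all: by end_near. Qed.

Lemma continuous_is_boundedop (f : {linear V -> W}) :
  continuous f -> (f : V -> W) \in @is_boundedop R k V W.
Proof.
move=> /linear_bounded_continuous/linear_boundedP fb; apply/is_boundedopP.
split; first exact: linearP.
by near +oo_K => M; exists M; near: M.
Unshelve. all: by end_near. Qed.

Lemma boundedopD (f g : boundedop V W) x : (f + g) x = f x + g x.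
Proof. by []. Qed.

Lemma boundedopZ (a : K) (f : boundedop V W) x : (a *: f) x = a *: f x.
Proof. by []. Qed.

Lemma boundedop_ext (f g : boundedop V W) : f =1 g -> f = g.
Proof. by move=> fg; apply/val_inj/funext. Qed.

Definition opnorm (f : boundedop V W) : K :=
  supremum 0 [set `|f x| | x in [set x | `|x| <= 1]].

Let opnorm_set_neq0 (f : boundedop V W) :
  [set `|f x| | x in [set x | `|x| <= 1]] !=set0.
Proof. by exists `|f 0|, 0 => //=; rewrite normr0. Qed.

Let opnorm_supremum (f : boundedop V W) :
  supremums [set `|f x| | x in [set x | `|x| <= 1]] (opnorm f).
Proof.
rewrite /opnorm /supremum ifN; last exact/set0P/opnorm_set_neq0.
apply: xgetPex; apply: scalar_supremums => //; first by move=> _ [x _ <-].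
have [M M0 fM] := boundedop_bounded f; exists M => _ [x /= x1 <-].
by rewrite (le_trans (fM x))// ler_piMr.
Qed.

Lemma opnorm_ge0 (f : boundedop V W) : 0 <= opnorm f.
Proof.
have [+ _] := opnorm_supremum f; move/(_ `|f 0|) => H.
by apply: le_trans (H _) => //; exists 0 => //=; rewrite normr0.
Qed.

Lemma opnormP (f : boundedop V W) x : `|f x| <= opnorm f * `|x|.
Proof.
have [->|x0] := eqVneq x 0; first by rewrite linear0 !normr0 mulr0.
have [+ _] := opnorm_supremum f => /(_ `|f (`|x|^-1 *: x)|) H.
rewrite -ler_pdivrMr ?normr_gt0//.
have E : `|f (`|x|^-1 *: x)| = `|f x| / `|x|.
  by rewrite linearZ normrZ normfV normr_id mulrC.
rewrite -E; apply: H; exists (`|x|^-1 *: x) => //=.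
by rewrite normrZ normfV normr_id mulVf// normr_eq0.
Qed.

Lemma opnorm_le (f : boundedop V W) (M : K) :
  (forall x, `|x| <= 1 -> `|f x| <= M) -> opnorm f <= M.
Proof.
by move=> fM; have [_] := opnorm_supremum f; apply => _ [x /= x1 <-]; exact: fM.
Qed.

Lemma opnormD (f g : boundedop V W) : opnorm (f + g) <= opnorm f + opnorm g.
Proof.
apply: opnorm_le => x x1; rewrite boundedopD (le_trans (ler_normD _ _))//.
by rewrite lerD// (le_trans (opnormP _ x))// ler_piMr// opnorm_ge0.
Qed.

Let opnormZ_le (a : K) (f : boundedop V W) : opnorm (a *: f) <= `|a| * opnorm f.
Proof.
apply: opnorm_le => x x1; rewrite boundedopZ normrZ ler_wpM2l//.
by rewrite (le_trans (opnormP _ x))// ler_piMr// opnorm_ge0.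
Qed.

Lemma opnormZ (a : K) (f : boundedop V W) : opnorm (a *: f) = `|a| * opnorm f.
Proof.
apply/le_anti; rewrite opnormZ_le/=.
have [->|a0] := eqVneq a 0; first by rewrite normr0 mul0r opnorm_ge0.
rewrite -ler_pdivlMl ?normr_gt0// -normfV.
by rewrite -[X in opnorm X <= _](scalerK a0) opnormZ_le.
Qed.

Lemma opnorm_eq0 (f : boundedop V W) : opnorm f = 0 -> f = 0.
Proof.
move=> f0; apply: boundedop_ext => x; apply/eqP; rewrite -normr_le0.
by have := opnormP f x; rewrite f0 mul0r.
Qed.

HB.instance Definition _ :=
  @Lmodule_isNormed.Build K (boundedop V W) opnorm opnormD opnormZ opnorm_eq0.

Lemma boundedop_normE (f : boundedop V W) :
  `|f| = supremum 0 [set `|f x| | x in [set x | `|x| <= 1]].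
Proof. by []. Qed.

End bounded_operators_lmodule.

Definition directed (I : Type) (le : I -> I -> Prop) :=
  [/\ inhabited I, forall i, le i i,
      forall i j l, le i j -> le j l -> le i l &
      forall i j, exists2 l, le i l & le j l].

(* For a directed relation, [u @ tails le --> p] is the convergence of the net
   [u] to [p]. *)
Definition tails (I : Type) (le : I -> I -> Prop) : set_system I :=
  filter_from [set: I] (fun i => [set j | le i j]).

Lemma tails_proper_filter (I : Type) (le : I -> I -> Prop) :
  directed le -> ProperFilter (tails le).
Proof.
move=> [[i0] lexx le_trans le_dir]; apply: filter_from_proper.
  apply: filter_from_filter; first by exists i0.
  move=> i j _ _; have [l il jl] := le_dir i j.
  by exists l => // m /= lm; split; apply: le_trans lm.
by move=> i _; exists i; exact: lexx.
Qed.

Section numerical_index.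
Context {R : realType} {k : field_kind}.
Local Notation K := (scalar_field R k).

Definition unit_ball (V : normedModType K) : set V := [set x | `|x| <= 1].
Definition unit_sphere (V : normedModType K) : set V := [set x | `|x| = 1].
Arguments unit_ball V : clear implicits.
Arguments unit_sphere V : clear implicits.

(* Boundedness is continuity here: see [boundedop_continuous] and
   [continuous_is_boundedop]. *)
Definition dual (V : normedModType K) := boundedop V K^o.

Definition weak_star (V : normedModType K) :=
  initial_topology (fun f : dual V => (f : V -> K) : {ptws V -> K}).

Lemma weak_star_cvgP (V : normedModType K) (F : set_system (dual V))
    (f : dual V) : Filter F ->
  (F --> (f : weak_star V)) <-> forall v, (fun g : dual V => g v) @ F --> f v.
Proof.
move=> FF; pose ev (g : dual V) : {ptws V -> K} := (g : V -> K).
have -> : (F --> (f : weak_star V)) <-> (ev @ F --> ev f).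
  split=> [Ff|evFf A [_ [[B oB <-] Bf BA]]].
    apply: cvg_trans (@initial_continuous _ _ ev f).
    by move=> A; exact: Ff.
  have : F (ev @^-1` B) by apply: evFf; exact: open_nbhs_nbhs.
  exact: filterS.
exact: (@pointwise_cvgP V K (ev @ F) (ev f) _).
Qed.

Definition extreme_points (V : lmodType K) (C : set V) : set V :=
  [set x | C x /\ forall y z (t : K), C y -> C z -> 0 < t -> t < 1 ->
    x = t *: y + (1 - t) *: z -> y = x /\ z = x].

Definition convex_hull (V : lmodType K) (A : set V) : set V :=
  smallest (@convex_set K V) A.

Definition weak_star_closed_convex_hull (V : normedModType K)
    (A : set (dual V)) : set (dual V) :=
  closure (convex_hull A : set (weak_star V)).

Variable X : normedModType K.

Definition tensor_fun (f : dual X) (x : X) : boundedop X X -> K^o :=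
  fun T => f (T x).

Lemma tensor_fun_boundedop f x : tensor_fun f x \in is_boundedop.
Proof.
apply/is_boundedopP; split=> [a S T|]; first exact: linearP.
exists (opnorm f * `|x|) => T; apply: le_trans (opnormP f _) _.
rewrite -mulrA ler_wpM2l ?opnorm_ge0// [leRHS]mulrC.
exact: opnormP.
Qed.

Definition tensor (f : dual X) (x : X) : dual (boundedop X X) :=
  BoundedOp (tensor_fun_boundedop f x).

Definition numerical_radius (T : boundedop X X) : K :=
  supremum 0 [set r | exists (f : dual X) (x : X),
    [/\ unit_sphere (dual X) f, unit_sphere X x, f x = 1 & r = `|f (T x)|]].

Definition numerical_index : K :=
  infimum 0 [set numerical_radius T | T in unit_sphere (boundedop X X)].

End numerical_index.

Arguments unit_ball {R k} V.
Arguments unit_sphere {R k} V.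

(* Main.v *)
(** The weak* topology on the dual ball only sees real parts of evaluations, and
    a real-linear functional dominated by the norm complexifies to an element of
    the dual ball.

    (a) => (b): if [n(X) = 1], every operator [T] is nearly normed by states
    [(f, x)]; in the face of the dual ball where functionals peak at [x], an
    extreme point maximizing the real part at [T x] does at least as well as
    [f].  So the tensors of (b) norm [L(X)], and a functional of the ball
    outside their closed convex hull could be separated from it by an operator
    violating this.

    (b) => (c) is Milman's converse of the Krein-Milman theorem.

    (d) => (a): the functional norming [T] given by Hahn-Banach may be chosen
    extreme, and is a limit of tensors, whose values at [T] are bounded by the
    numerical radius. *)

Require Import Defs.
From HB Require Import structures.
From mathcomp Require Import all_boot all_order all_algebra.
From mathcomp Require Import complex.
From mathcomp Require Import all_classical all_reals all_analysis.
From mathcomp Require Import ring lra.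

Import Order.TTheory GRing.Theory Num.Theory.
Import numFieldNormedType.Exports.

Local Open Scope classical_set_scope.
Local Open Scope ring_scope.

Set Implicit Arguments.
Unset Strict Implicit.
Unset Printing Implicit Defensive.

(** * Real parts of scalars *)

Section scalar_parts.
Context {R : realType} {k : field_kind}.
Local Notation K := (scalar_field R k).

Definition re_part : K -> R :=
  match k return scalar_field R k -> R with
  | RealScalars => id
  | ComplexScalars => @complex.Re R
  end.

Definition of_real : R -> K :=
  match k return R -> scalar_field R k with
  | RealScalars => id
  | ComplexScalars => real_complex R
  end.

(* The imaginary unit, or 0 when the scalars are real: this makes
   [scalar_decomp] and the complexification of real functionals uniform. *)
Definition imag_unit : K :=
  match k return scalar_field R k with
  | RealScalars => 0
  | ComplexScalars => 'i%C
  end.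

Lemma re_partD : {morph re_part : x y / x + y}.
Proof. by rewrite /re_part; case: k => // -[a b] [c d]. Qed.

Lemma re_part_of_realM r z : re_part (of_real r * z) = r * re_part z.
Proof.
rewrite /re_part /of_real; case: k z => //= -[a b] /=.
by rewrite mul0r subr0.
Qed.

Lemma of_realK : cancel of_real re_part.
Proof. by rewrite /re_part /of_real; case: k. Qed.

Lemma of_realD : {morph of_real : x y / x + y}.
Proof. by rewrite /of_real; case: k => // x y; rewrite rmorphD. Qed.

Lemma of_realM : {morph of_real : x y / x * y}.
Proof. by rewrite /of_real; case: k => // x y; rewrite rmorphM. Qed.

Lemma of_real1 : of_real 1 = 1.
Proof. by rewrite /of_real; case: k. Qed.

Lemma of_real0 : of_real 0 = 0.
Proof. by rewrite /of_real; case: k. Qed.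

Lemma ler_of_real : {mono of_real : x y / x <= y}.
Proof. by rewrite /of_real; case: k => //= x y; rewrite lecR. Qed.

Lemma re_part_le : {homo re_part : x y / x <= y}.
Proof.
rewrite /re_part; case: k => //= -[a b] [c d].
by rewrite lecE /= => /andP[].
Qed.

Lemma ge0_of_real z : 0 <= z -> of_real (re_part z) = z.
Proof.
rewrite /of_real /re_part; case: k z => //= -[a b].
by rewrite lecE /= => /andP[/eqP -> _].
Qed.

Lemma ler_re_part_norm z : re_part z <= re_part `|z|.
Proof.
rewrite /re_part; case: k z => /= [z|[a b]]; first exact: ler_norm.
rewrite (le_trans (ler_norm _))// -sqrtr_sqr ler_sqrt ?addr_ge0 ?sqr_ge0//.
by rewrite lerDl sqr_ge0.
Qed.

(** Over the complex numbers Re(iz) = -Im z, so this is the splitting into real and imaginary parts;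
    over the reals the second term vanishes. *)
Lemma scalar_decomp z :
  z = of_real (re_part z) - of_real (re_part (imag_unit * z)) * imag_unit.
Proof.
rewrite /of_real /re_part /imag_unit; case: k z => /= [z|[a b]].
  by rewrite mulr0 subr0.
apply/eqP; rewrite eq_complex /=.
by rewrite !(mul0r, mulr0, mulr1, mul1r, subr0, addr0, add0r, oppr0, sub0r,
  opprK) !eqxx.
Qed.

Lemma imag_unitP : imag_unit = 0 \/ imag_unit * imag_unit = -1.
Proof.
rewrite /imag_unit; case: k; [by left|right].
by rewrite -expr2 complexiE sqrCi.
Qed.

Lemma re_part_imag_unit : re_part imag_unit = 0.
Proof. by rewrite /re_part /imag_unit; case: k. Qed.

Lemma norm_imag_unit : `|imag_unit| <= 1.
Proof.
have [->|j2] := imag_unitP; first by rewrite normr0.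
by rewrite -(@expr_le1 _ 2)// -normrX expr2 j2 normrN1.
Qed.

End scalar_parts.

Section scalar_parts_theory.
Context {R : realType} {k : field_kind}.
Local Notation K := (scalar_field R k).
Local Notation re_part := (@re_part R k).
Local Notation of_real := (@of_real R k).
Local Notation imag_unit := (@imag_unit R k).

Lemma re_part0 : re_part 0 = 0.
Proof. by apply: (addrI (re_part 0)); rewrite -re_partD !addr0. Qed.

Lemma re_partN z : re_part (- z) = - re_part z.
Proof. by apply: (addrI (re_part z)); rewrite -re_partD !subrr re_part0. Qed.

Lemma re_partB : {morph re_part : x y / x - y}.
Proof. by move=> x y; rewrite re_partD re_partN. Qed.

Lemma of_realN r : of_real (- r) = - of_real r.
Proof. by apply: (addrI (of_real r)); rewrite -of_realD !subrr of_real0. Qed.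

Lemma of_realB : {morph of_real : x y / x - y}.
Proof. by move=> x y; rewrite of_realD of_realN. Qed.

Lemma ltr_of_real : {mono of_real : x y / x < y}.
Proof.
move=> x y; rewrite !lt_neqAle ler_of_real.
by rewrite (inj_eq (can_inj (@of_realK R k))).
Qed.

Lemma of_real_ge0 r : (0 <= of_real r) = (0 <= r).
Proof. by rewrite -[0 in LHS](@of_real0 R k) ler_of_real. Qed.

Lemma norm_of_real r : `|of_real r| = of_real `|r|.
Proof.
have [r0|r0] := ger0P r; first by rewrite ger0_norm// of_real_ge0.
by rewrite of_realN -normrN -of_realN ger0_norm// of_real_ge0 oppr_ge0 ltW.
Qed.

Lemma re_part_le_of_real z r : `|z| <= of_real r -> re_part z <= r.
Proof.
move=> zr; apply: le_trans (ler_re_part_norm z) _.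
by rewrite -[leRHS](@of_realK R k); apply: re_part_le.
Qed.

Lemma of_real_norm (V : normedModType K) (x : V) :
  of_real (re_part `|x|) = `|x|.
Proof. by rewrite ge0_of_real. Qed.

Lemma rotation z : exists2 c : K, `|c| = 1 & c * z = `|z|.
Proof.
have [->|z0] := eqVneq z 0; first by exists 1; rewrite ?normr1 ?mulr0 ?normr0.
exists (`|z| / z); last by rewrite mulfVK.
by rewrite normrM normfV normr_id divff// normr_eq0.
Qed.

Lemma norm_le_re_parts z :
  `|z| <= of_real (`|re_part z| + `|re_part (imag_unit * z)|).
Proof.
rewrite [in leLHS](scalar_decomp z) of_realD (le_trans (ler_normB _ _))//.
rewrite !norm_of_real lerD2l normrM norm_of_real ler_piMr ?norm_imag_unit//.
by rewrite of_real_ge0.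
Qed.

Lemma continuous_re_part : continuous (re_part : K -> R).
Proof.
move=> z; apply/(@cvgrPdist_lt _ _ _ _ (nbhs_filter z)) => e e0; near=> y.
rewrite -re_partB; have := ltr_of_real `|re_part (z - y)| e => <-.
rewrite -norm_of_real; apply: (@le_lt_trans _ _ `|z - y|).
  rewrite norm_of_real -(@of_real_norm K^o (z - y)) ler_of_real.
  rewrite ler_norml ler_re_part_norm andbT lerNl -re_partN -normrN.
  exact: ler_re_part_norm.
near: y; apply/nbhs_normP; exists (of_real e) => //=.
by rewrite -(@of_real0 R k) ltr_of_real.
Unshelve. all: by end_near. Qed.

(* The complexification of a real functional l is x |-> l x - i l(i x); rotating
   the value at a given point onto the positive reals bounds its norm. *)
Lemma dual_of_real (V : normedModType K) (l : V -> R) :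
  {morph l : x y / x + y} ->
  (forall r x, l (of_real r *: x) = r * l x) ->
  (forall x, l x <= re_part `|x|) ->
  exists2 f : dual V, unit_ball (dual V) f & forall x, re_part (f x) = l x.
Proof.
move=> lD lZ l_le; pose j := imag_unit.
have l0 : l 0 = 0 by rewrite -(scale0r (0 : V)) -(@of_real0 R k) lZ mul0r.
pose f (x : V) : K^o := of_real (l x) - of_real (l (j *: x)) * j.
have fD : {morph f : x y / x + y}.
  by move=> x y; rewrite /f scalerDr !lD !of_realD; ring.
have lN x : l (- x) = - l x.
  by apply: (addrI (l x)); rewrite -lD !subrr l0.
have fZ a x : f (a *: x) = a * f x.
  rewrite {1 2}(scalar_decomp a) /f.
  set r := re_part a; set s := re_part _; rewrite -/j.
  rewrite scalerA mulrBr !scalerBl !lD !lN -!scalerA !lZ.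
  have [j0|j2] : j = 0 \/ j * j = -1 := imag_unitP.
    by rewrite j0 !scale0r l0 !(mulr0, subr0, of_realM).
  have -> : l (j *: (of_real r *: x)) = r * l (j *: x).
    by rewrite scalerA mulrC -scalerA lZ.
  have -> : l (j *: (of_real s *: (j *: x))) = - (s * l x).
    by rewrite scalerA mulrC -scalerA lZ scalerA j2 scaleN1r lN mulrN.
  rewrite !(of_realB, of_realD, of_realM, of_realN).
  ring: j2.
have re_f x : re_part (f x) = l x.
  rewrite /f re_partB of_realK re_part_of_realM re_part_imag_unit mulr0.
  by rewrite subr0.
have f_le x : `|f x| <= `|x|.
  have [c c1 cfx] := rotation (f x).
  rewrite -(@of_real_norm K^o (f x)) -(of_real_norm x) ler_of_real.
  by rewrite -cfx -fZ re_f (le_trans (l_le _))// normrZ c1 mul1r.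
have fb : f \in is_boundedop.
  apply/is_boundedopP; split=> [a x y|]; first by rewrite fD fZ.
  by exists 1 => x; rewrite mul1r.
exists (BoundedOp fb) => //.
by apply: opnorm_le => x; apply: le_trans (f_le _).
Qed.

End scalar_parts_theory.

(** * The weak* topology *)

Section weak_star_topology.
Context {R : realType} {k : field_kind}.
Local Notation K := (scalar_field R k).
Local Notation re_part := (@re_part R k).
Local Notation of_real := (@of_real R k).
Local Notation imag_unit := (@imag_unit R k).
Variable V : normedModType K.
Implicit Types (v : V) (f g h : dual V).

Definition re_eval v f : R := re_part (f v).

Lemma re_evalD v f g : re_eval v (f + g) = re_eval v f + re_eval v g.
Proof. exact: re_partD. Qed.

Lemma re_evalZ v r f : re_eval v (of_real r *: f) = r * re_eval v f.
Proof. exact: re_part_of_realM. Qed.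

Lemma re_eval_le v f : unit_ball (dual V) f -> re_eval v f <= re_part `|v|.
Proof.
move=> f1; apply: re_part_le_of_real; rewrite of_real_norm.
by rewrite (le_trans (opnormP f v))// ler_piMl.
Qed.

Lemma re_eval_inj f g : (forall v, re_eval v f = re_eval v g) -> f = g.
Proof.
move=> fg; apply: boundedop_ext => v.
rewrite [f v]scalar_decomp [g v]scalar_decomp.
have fj h : imag_unit * h v = h (imag_unit *: v) by rewrite linearZ.
by rewrite !fj; congr (of_real _ - of_real _ * _); exact: fg.
Qed.

Lemma continuous_re_eval v : continuous (re_eval v : weak_star V -> R).
Proof.
move=> f.
have /weak_star_cvgP/(_ v) : nbhs (f : weak_star V) --> (f : weak_star V).
  exact: cvg_id.
move=> fv; by have := cvg_comp _ _ fv (@continuous_re_part R k (f v)).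
Qed.

(** The imaginary part of an evaluation at v is, up to sign, the real part of the evaluation at iv.
    The real parts at v and at iv therefore each contribute less than half of the allowed error. *)
Lemma cvg_re_eval (F : set_system (dual V)) f : Filter F ->
  (forall v, re_eval v @ F --> re_eval v f) -> F --> (f : weak_star V).
Proof.
move=> FF Ff; apply/weak_star_cvgP => v; apply/cvgrPdist_lt => e e0.
pose d := re_part e / 2.
have eE : of_real (re_part e) = e by rewrite ge0_of_real// ltW.
have d0 : 0 < d by rewrite divr_gt0// -(@ltr_of_real R k) eE of_real0.
have Fv u : \forall g \near F, `|re_eval u f - re_eval u g| < d.
  by have /cvgrPdist_lt := Ff u; exact.
near=> g; rewrite (le_lt_trans (norm_le_re_parts _))//.
rewrite -eE ltr_of_real (splitr (re_part e)) ltrD//.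
  by rewrite re_partB; near: g; exact: Fv.
have fj h : imag_unit * h v = h (imag_unit *: v) by rewrite linearZ.
by rewrite mulrBr !fj re_partB; near: g; exact: Fv.
Unshelve. all: by end_near. Qed.

(** The sets given by finitely many real coordinates and a radius generate a filter that converges
    to f by [cvg_re_eval], hence contains every neighborhood of f. Conversely such a set is a finite
    intersection of neighborhoods. *)
Lemma weak_star_nbhsP f (W : set (weak_star V)) :
  nbhs (f : weak_star V) W <->
  exists (s : seq V), exists2 e : R, 0 < e &
    forall g, (forall v, v \in s -> `|re_eval v f - re_eval v g| < e) -> W g.
Proof.
pose D (p : seq V * R) : set (dual V) :=
  [set g | forall v, v \in p.1 -> `|re_eval v f - re_eval v g| < p.2].
pose F := filter_from [set p : seq V * R | 0 < p.2] D.
have FF : Filter F.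
  apply: filter_from_filter; first by exists ([::], 1) => /=.
  move=> [s e] [t d] /= e0 d0; exists (s ++ t, Num.min e d).
    by rewrite /= lt_min e0 d0.
  move=> g /= Dg; split=> v /= vs.
    by have := Dg v; rewrite /= mem_cat vs lt_min => /(_ isT)/andP[].
  by have := Dg v; rewrite /= mem_cat vs orbT lt_min => /(_ isT)/andP[].
have Ff : F --> (f : weak_star V).
  apply: cvg_re_eval => v; apply/cvgrPdist_lt => e e0.
  by exists ([:: v], e) => //= g /= /(_ v); rewrite inE eqxx; exact.
split=> [/Ff[[s e] /= e0 sW]|[s [e e0 sW]]].
  by exists s, e.
have : \forall g \near nbhs (f : weak_star V),
    forall v, v \in s -> `|re_eval v f - re_eval v g| < e.
  elim: s {sW} => [|u s IH]; first
    by apply: (@nearW _ _ _ (nbhs_filter (f : weak_star V))) => g v.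
  near=> g => v; rewrite inE => /predU1P[->|]; last first.
    by move: v; near: g; exact: IH.
  near: g; have := @continuous_re_eval u f; move=> /cvgrPdist_lt.
  exact.
apply: filterS => g; exact: sW.
Unshelve. all: by end_near. Qed.

Lemma hausdorff_weak_star : hausdorff_space (weak_star V).
Proof.
move=> f g fg; apply: re_eval_inj => v; apply: (@Rhausdorff R).
move=> A B fA gB.
have [h [hA hB]] := fg _ _ (continuous_re_eval fA) (continuous_re_eval gB).
by exists (re_eval v h).
Qed.

(** Banach-Alaoglu. Along an ultrafilter on the ball every real evaluation stays in a segment and so
    converges; the pointwise limit is real-linear and dominated by the norm, and [dual_of_real]
    turns it into an element of the ball. *)
Lemma compact_unit_ball : compact (unit_ball (dual V) : set (weak_star V)).
Proof.
rewrite compact_ultra => F FU FB.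
have FP : ProperFilter F by exact: ultra_proper.
have lim v : exists l : R, re_eval v @ F --> l.
  have [|l [_ Fl]] := @segment_compact R (- re_part `|v|) (re_part `|v|)
      (re_eval v @ F).
    apply: (@filterS _ F _ _ _ _ FB) => g g1.
    rewrite /= in_itv /= re_eval_le// andbT lerNl -(normrN v).
    by rewrite (le_trans _ (re_eval_le _ g1))// /re_eval linearN re_partN.
  exists l => A lA; have [//|FnA] := in_ultra_setVsetC (re_eval v @^-1` A) FU.
  by have [r [/= nAr Ar]] := Fl (~` A) A FnA lA.
have [l lP] := choice lim.
have limE v r : re_eval v @ F --> r -> l v = r.
  by move=> ?; apply: (@cvg_unique _ (@Rhausdorff R)) (lP v) _.
have [f f1 fl] : exists2 f : dual V, unit_ball (dual V) f &
    forall v, re_part (f v) = l v.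
  apply: dual_of_real.
  - move=> x y; apply: limE.
    rewrite (_ : re_eval _ = re_eval x \+ re_eval y); last first.
      by apply/funext => g /=; rewrite /re_eval linearD re_partD.
    exact: cvgD.
  - move=> r x; apply: limE.
    rewrite (_ : re_eval _ = (fun g => r * re_eval x g)); last first.
      apply/funext => g; rewrite /re_eval linearZ.
      exact: re_part_of_realM.
    exact: cvgMr.
  - move=> x; apply: (cvgr_to_le (lP x)).
    by apply: filterS FB => g; exact: re_eval_le.
exists f; split=> //=; apply: cvg_re_eval => v.
by rewrite /re_eval fl; exact: lP.
Unshelve. all: by end_near. Qed.

End weak_star_topology.

(** * Extreme points of the dual ball *)

Section weak_star_convexity.
Context {R : realType} {k : field_kind}.
Local Notation K := (scalar_field R k).
Local Notation re_part := (@re_part R k).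
Local Notation of_real := (@of_real R k).
Variable V : normedModType K.
Implicit Types (v : V) (f g h : dual V) (C D F : set (dual V)).
Local Notation B := (unit_ball (dual V)).
Local Notation wclosed C := (closed (C : set (weak_star V))).
Local Notation wcompact C := (compact (C : set (weak_star V))).

Definition segment_point (t : R) f g : dual V :=
  of_real t *: f + of_real (1 - t) *: g.

Lemma re_eval_segment v t f g :
  re_eval v (segment_point t f g) = t * re_eval v f + (1 - t) * re_eval v g.
Proof. by rewrite re_evalD !re_evalZ. Qed.

Definition real_convex C := forall (t : R) f g,
  0 <= t -> t <= 1 -> C f -> C g -> C (segment_point t f g).

Lemma real_convexP C :
  convex_set (C : set (convex_lmodType (dual V))) <-> real_convex C.
Proof.
split=> [cC t f g t0 t1 Cf Cg|cC f g l].
  have t0' : 0 <= of_real t by rewrite of_real_ge0.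
  have t1' : of_real t <= 1 by rewrite -(@of_real1 R k) ler_of_real.
  have := cC f g (Itv01 t0' t1'); rewrite !inE => /(_ Cf Cg).
  by rewrite /segment_point of_realB of_real1.
rewrite !inE => Cf Cg.
have l0 : 0 <= l%:num by exact: ge0.
have l1 : l%:num <= 1 by exact: le1.
have lE := ge0_of_real l0.
have := cC (re_part l%:num) f g; rewrite /segment_point of_realB of_real1 lE.
apply => //.
  by rewrite -(@of_real_ge0 R k) lE.
by rewrite -(@ler_of_real R k) lE of_real1.
Qed.

(** The extreme sets of the Krein-Milman argument; neither convexity nor closedness is part of the
    notion. *)
Definition extreme_subset F := F `<=` B /\ forall (t : R) f g,
  0 < t -> t < 1 -> B f -> B g -> F (segment_point t f g) -> F f /\ F g.

Lemma extreme_subset_ball : extreme_subset B.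
Proof. by split. Qed.

Lemma extreme_subset1 f : extreme_subset [set f] -> extreme_points B f.
Proof.
move=> [fB fE]; split; first exact: fB.
move=> g h t gB hB t0 t1 fgh.
(* A positive scalar is real, so extremality tested with weights in the scalar field reduces to real
   weights. *)
have tE : of_real (re_part t) = t by rewrite ge0_of_real// ltW.
apply: (fE (re_part t)) => //.
- by rewrite -(@ltr_of_real R k) tE of_real0.
- by rewrite -(@ltr_of_real R k) tE of_real1.
- by rewrite /= fgh /segment_point of_realB tE of_real1.
Qed.

Lemma extreme_pointsP f : extreme_points B f -> forall (t : R) g h,
  0 < t -> t < 1 -> B g -> B h -> f = segment_point t g h -> g = f /\ h = f.
Proof.
move=> [_ fE] t g h t0 t1 gB hB fgh; apply: (fE g h (of_real t)) => //.
- by rewrite -(@of_real0 R k) ltr_of_real.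
- by rewrite -(@of_real1 R k) ltr_of_real.
- by rewrite -(@of_real1 R k) -of_realB.
Qed.

Definition maximal_face v F :=
  [set f | F f /\ forall g, F g -> re_eval v g <= re_eval v f].

(** A weighted average with positive weights reaches the maximum only if both averaged values do. *)
Lemma extreme_maximal_face v F :
  extreme_subset F -> extreme_subset (maximal_face v F).
Proof.
move=> [FB FE]; split=> [f [/FB]//|t f g t0 t1 fB gB [Fm m]].
have [Ff Fg] := FE _ _ _ t0 t1 fB gB Fm.
have := m _ Ff; have := m _ Fg; rewrite re_eval_segment => mg mf.
split; split=> // h /m; rewrite re_eval_segment => mh; nra.
Qed.

Lemma closed_re_eval_ge v r : wclosed [set f | r <= re_eval v f].
Proof.
apply: (@closed_comp (weak_star V) R) (@closed_ge _ r) => f _.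
exact: continuous_re_eval.
Qed.

Lemma closed_re_eval_le v r : wclosed [set f | re_eval v f <= r].
Proof.
apply: (@closed_comp (weak_star V) R) (@closed_le _ r) => f _.
exact: continuous_re_eval.
Qed.

Lemma closed_maximal_face v F : wclosed F -> wclosed (maximal_face v F).
Proof.
move=> cF; rewrite (_ : maximal_face v F =
    F `&` \bigcap_(g in F) [set f | re_eval v g <= re_eval v f]).
  by apply: closedI => //; apply: closed_bigI => g _; exact: closed_re_eval_ge.
by apply/seteqP; split=> f [Ff H]; split=> //.
Qed.

Lemma compact_of_closed F : F `<=` B -> wclosed F -> wcompact F.
Proof.
by move=> FB cF; exact: subclosed_compact cF (@compact_unit_ball R k V) FB.
Qed.

Lemma maximal_face_nonempty v F :
  F !=set0 -> wcompact F -> maximal_face v F !=set0.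
Proof.
move=> F0 cF; have [|f] := @compact_EVT_max (weak_star V) R (re_eval v) F F0 cF.
  by apply: continuous_subspaceT; exact: continuous_re_eval.
rewrite inE => Ff fmax; exists f; split=> // g Fg; apply: fmax; exact: mem_set.
Qed.

(** Cantor's intersection theorem for the chain of closed sets A \ X, phrased through the removed
    sets X to fit the form of Zorn's lemma that bounds chains by unions. *)
Lemma chain_setD_bigcup_nonempty (T : topologicalType) (A : set T)
    (G : set (set T)) :
  A !=set0 -> compact A -> total_on G subset ->
  (forall X, G X -> closed (A `\` X) /\ A `\` X !=set0) ->
  A `\` \bigcup_(X in G) X !=set0.
Proof.
move=> A0 cA totG GP.
have [[X0 GX0]|Gn] := pselect (G !=set0); last first.
  case: A0 => a Aa; exists a; split=> // -[X GX _]; apply: Gn; by exists X.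
pose H := filter_from G (fun X => A `\` X).
have HH : ProperFilter H.
  apply: filter_from_proper; last by move=> X /GP[].
  apply: filter_from_filter; first by exists X0.
  move=> X Y GX GY; have [XY|YX] := totG _ _ GX GY.
    by exists Y => // p [Ap Yp]; split; split=> // /XY.
  by exists X => // p [Ap Xp]; split; split=> // /YX.
have HA : H A by exists X0 => // p [].
have [p [Ap Hp]] := cA _ HH HA; exists p; split=> // -[X GX Xp].
have [clX _] := GP _ GX.
have : closure (A `\` X) p.
  by move=> U Up; apply: Hp => //; exists X.
by rewrite -(closure_id _).1// => -[].
Qed.

(* A minimal closed extreme subset is a singleton, because the maximal faces of
   all the [re_eval v] cannot be proper. *)
Lemma extreme_point_in F : F !=set0 -> wclosed F -> extreme_subset F ->
  exists2 f, F f & extreme_points B f.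
Proof.
move=> F0 cF eF.
(* Zorn is applied to the removed part A: a maximal A leaves a minimal nonempty closed extreme
   subset of F. *)
pose P (A : set (dual V)) :=
  [/\ F `\` A !=set0, wclosed (F `\` A) & extreme_subset (F `\` A)].
have [A [[[f [Ff Af]] cA eA] Amax]] :
    exists A, P A /\ forall A', A `<` A' -> ~ P A'.
  apply: Zorn_bigcup => G GP totG; split.
  - apply: (@chain_setD_bigcup_nonempty (weak_star V)) => //.
      exact: compact_of_closed eF.1 cF.
    by move=> X /GP[].
  - rewrite setDE setC_bigcup.
    have [[X0 GX0]|Gn] := pselect (G !=set0).
      rewrite setIC -bigcapIl; last by exists X0.
      by apply: closed_bigI => X /GP[_ + _]; rewrite setDE setIC.
    rewrite (_ : G = set0) ?bigcap_set0 ?setIT//.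
    by apply/seteqP; split=> // X GX; apply: Gn; exists X.
  - split=> [g [/eF.1]//|t g h t0 t1 gB hB [Fm Gm]].
    have [Fg Fh] := eF.2 _ _ _ t0 t1 gB hB Fm.
    split; split=> // -[X GX Xp]; have [_ _ [_ XE]] := GP _ GX.
      have [|[]//] := XE _ _ _ t0 t1 gB hB.
      by split=> // Xm; apply: Gm; exists X.
    have [|_ []//] := XE _ _ _ t0 t1 gB hB.
    by split=> // Xm; apply: Gm; exists X.
have mface v : F `\` A `<=` maximal_face v (F `\` A).
  (* If the maximal face were proper, removing its complement would remove strictly more than A and
     still leave a nonempty closed extreme set. *)
  apply: contrapT => nsub; apply: (Amax (~` maximal_face v (F `\` A))).
    split; last first.
      move=> sA; apply: nsub => g [Fg Ag]; apply: contrapT => /sA; exact: Ag.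
    by move=> g Ag [[_ /(_ Ag)]].
  rewrite /P; have -> : F `\` ~` maximal_face v (F `\` A) =
      maximal_face v (F `\` A).
    apply/seteqP; split=> g; first by case=> _ /contrapT.
    by move=> mg; split; [case: mg => -[]|apply].
  split.
  - apply: maximal_face_nonempty; first by exists f.
    exact: compact_of_closed eA.1 cA.
  - exact: closed_maximal_face.
  - exact: extreme_maximal_face.
have A1 : F `\` A = [set f].
  apply/seteqP; split=> [g Ag|_ ->//]; apply: re_eval_inj => v.
  have [_ gm] := mface v _ Ag; have [_ fm] := mface v f (conj Ff Af).
  by apply/eqP; rewrite eq_le gm// fm.
by exists f => //; apply: extreme_subset1; rewrite -A1.
Qed.

End weak_star_convexity.

(** * Weak* separation and Milman's theorem *)

Section separation_and_milman.
Context {R : realType} {k : field_kind}.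
Local Notation K := (scalar_field R k).
Local Notation re_part := (@re_part R k).
Local Notation of_real := (@of_real R k).
Variable V : normedModType K.
Implicit Types (v : V) (f g h : dual V) (C D F A : set (dual V)).
Local Notation B := (unit_ball (dual V)).
Local Notation wclosed C := (closed (C : set (weak_star V))).
Local Notation wcompact C := (compact (C : set (weak_star V))).
Local Notation wclosure C := (closure (C : set (weak_star V))).

(** Two points of C that approximate f and g within e on finitely many coordinates have a convex
    combination that approximates that of f and g within e on the same coordinates. *)
Lemma closure_real_convex C : real_convex C -> real_convex (wclosure C).
Proof.
move=> cC t f g t0 t1 Cf Cg U /weak_star_nbhsP[s [e e0 sU]].
have near_pt h : wclosure C h ->
    exists2 h', C h' & forall v, v \in s -> `|re_eval v h - re_eval v h'| < e.
  move=> Ch; have [|h' []] := Ch [set h' | forall v, v \in s ->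
      `|re_eval v h - re_eval v h'| < e].
    by apply/weak_star_nbhsP; exists s, e.
  by exists h'.
have [f' Cf' ff'] := near_pt _ Cf; have [g' Cg' gg'] := near_pt _ Cg.
exists (segment_point t f' g'); split; first exact: cC.
apply: sU => v vs; rewrite !re_eval_segment.
have /ltr_normlP[fa fb] := ff' _ vs; have /ltr_normlP[ga gb] := gg' _ vs.
have lt_conv x y : x < e -> y < e -> t * x + (1 - t) * y < e.
  move=> xe ye; have [->|tn0] := eqVneq t 0.
    by rewrite mul0r add0r subr0 mul1r.
  have tp : 0 < t by rewrite lt_neqAle eq_sym tn0.
  have : 0 < t * (e - x) by rewrite mulr_gt0// subr_gt0.
  have : 0 <= (1 - t) * (e - y) by rewrite mulr_ge0// subr_ge0// ltW.
  lra.
apply/ltr_normlP; split; first by have := lt_conv _ _ fa ga; lra.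
by have := lt_conv _ _ fb gb; lra.
Qed.

Lemma real_convex_hull A : real_convex (convex_hull A).
Proof.
apply/real_convexP => f g l; rewrite !inE => Af Ag M [cM AM].
have := cM f g l; rewrite !inE; apply; [exact: Af|exact: Ag].
Qed.

Lemma closed_convex_hull_sub A D : A `<=` D -> wclosed D -> real_convex D ->
  weak_star_closed_convex_hull A `<=` D.
Proof.
move=> AD cD rD; have /closure_id DE := cD; rewrite [D in _ `<=` D]DE.
apply: (@closureS (weak_star V)); apply: smallest_sub => //.
exact/real_convexP.
Qed.

Lemma real_convex_ball : real_convex B.
Proof.
move=> t f g t0 t1 f1 g1; rewrite /unit_ball /= (le_trans (ler_normD _ _))//.
rewrite !normrZ !norm_of_real !ger0_norm ?subr_ge0//.
have -> : 1 = of_real t * 1 + of_real (1 - t) * 1.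
  by rewrite !mulr1 -of_realD addrC subrK of_real1.
by rewrite lerD// ler_wpM2l// of_real_ge0 ?subr_ge0.
Qed.

Lemma closed_ball : wclosed B.
Proof.
exact: compact_closed (@hausdorff_weak_star R k V) (@compact_unit_ball R k V).
Qed.

Lemma real_convex_re_eval_le v r : real_convex [set f | re_eval v f <= r].
Proof. by move=> t f g t0 t1 /= fr gr; rewrite re_eval_segment; nra. Qed.

Lemma real_convexI C D :
  real_convex C -> real_convex D -> real_convex (C `&` D).
Proof.
by move=> cC cD t f g t0 t1 [Cf Df] [Cg Dg]; split; [exact: cC|exact: cD].
Qed.

Lemma continuous_re_eval_dist (s : seq V) f :
  continuous ((fun g => \sum_(v <- s) (re_eval v f - re_eval v g) ^+ 2)
    : weak_star V -> R).
Proof.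
move=> g; have FF := nbhs_filter (g : weak_star V); apply: cvg_big => [|v _].
  exact: add_continuous.
have c : (re_eval v f - re_eval v h) @[h --> (g : weak_star V)] -->
    re_eval v f - re_eval v g.
  by apply: cvgB; [exact: cvg_cst|exact: continuous_re_eval].
exact: (cvgM c c).
Qed.

(* The functional is the direction to f from the point h of C closest to f, for
   the Euclidean distance on the coordinates of a basic neighborhood of f that
   misses C. *)
Lemma separation C f :
  C !=set0 -> wcompact C -> wclosed C -> real_convex C -> ~ C f ->
  exists v r, (forall g, C g -> re_eval v g <= r) /\ r < re_eval v f.
Proof.
move=> C0 coC clC cvC Cf.
have : nbhs (f : weak_star V) (~` C).
  by apply: open_nbhs_nbhs; split=> //; exact: closed_openC.
move=> /weak_star_nbhsP[s [e e0 sC]].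
pose q g := \sum_(v <- s) (re_eval v f - re_eval v g) ^+ 2.
have [|h] := @compact_EVT_min (weak_star V) R q C C0 coC.
  by apply: continuous_subspaceT; exact: continuous_re_eval_dist.
rewrite inE => Ch hmin.
have {}hmin g : C g -> q h <= q g by move=> Cg; apply: hmin; exact: mem_set.
pose a v := re_eval v f - re_eval v h.
(* Evaluation at T is the Euclidean inner product with f - h in the coordinates s. *)
pose T := \sum_(v <- s) of_real (a v) *: v.
have re_T g : re_eval T g = \sum_(v <- s) a v * re_eval v g.
  rewrite /re_eval /T linear_sum (big_morph re_part (@re_partD R k) re_part0).
  by apply: eq_bigr => v _; rewrite linearZ re_part_of_realM.
exists T, (re_eval T h); split=> [g Cg|]; last first.
  rewrite -subr_gt0 !re_T -sumrB lt_neqAle; apply/andP; split; last first.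
    by apply: sumr_ge0 => v _; rewrite -mulrBr -expr2 sqr_ge0.
  apply/eqP => /esym/eqP; rewrite psumr_eq0; last first.
    by move=> v _; rewrite -mulrBr -expr2 sqr_ge0.
  move=> /allP s0; apply: (sC h) => // v /s0 /=.
  by rewrite -mulrBr -expr2 sqrf_eq0 /a => /eqP ->; rewrite normr0.
rewrite leNgt; apply/negP; rewrite -subr_gt0 !re_T -sumrB.
pose b v := re_eval v g - re_eval v h.
rewrite (eq_bigr (fun v => a v * b v)); last by move=> v _; rewrite -mulrBr.
set S := \sum_(v <- s) _ => S0; pose Q := \sum_(v <- s) b v ^+ 2.
have Q0 : 0 <= Q by apply: sumr_ge0 => v _; exact: sqr_ge0.
(* Moving from h towards g changes the squared distance to f at initial rate -2S, so S > 0 would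
   contradict the choice of h. *)
have qE t : q (segment_point t g h) = q h - 2 * t * S + t ^+ 2 * Q.
  rewrite /q /S /Q !mulr_sumr -sumrB -big_split /=.
  by apply: eq_bigr => v _; rewrite re_eval_segment /a /b; ring.
have SQ : 0 < S + Q by rewrite ltr_wpDr.
(* With this t one has t Q = S - t S, so q changes by - t S - t ^ 2 S < 0; the denominator S + Q,
   unlike Q, is surely positive and keeps t at most 1. *)
pose t := S / (S + Q).
have t0 : 0 < t by rewrite divr_gt0.
have t1 : t <= 1 by rewrite ler_pdivrMr// mul1r lerDl.
have := hmin _ (cvC t g h (ltW t0) t1 Cg Ch); rewrite qE => qt.
have tS : t * (S + Q) = S by rewrite mulfVK// gt_eqF.
nra.
Qed.

(** For nonempty convex C and D this is the convex hull of their union; as the image of [0, 1] x C x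
    D it inherits compactness without taking a closure. *)
Definition join_set C D : set (dual V) :=
  [set segment_point p.1 p.2.1 p.2.2 | p in `[0, 1]%classic `*` (C `*` D)].

Lemma segment_point0 f g : segment_point 0 f g = g.
Proof.
by rewrite /segment_point of_real0 scale0r add0r subr0 of_real1 scale1r.
Qed.

Lemma segment_point1 f g : segment_point 1 f g = f.
Proof.
by rewrite /segment_point subrr of_real0 scale0r addr0 of_real1 scale1r.
Qed.

Lemma compact_join C D : wcompact C -> wcompact D -> wcompact (join_set C D).
Proof.
move=> cC cD; apply: (@continuous_compact (R * (weak_star V * weak_star V))%type
    (weak_star V) (fun p => segment_point p.1 p.2.1 p.2.2)); last first.
  apply: compact_setX; first exact: segment_compact.
  exact: compact_setX.
apply: continuous_subspaceT => p; apply: cvg_re_eval => v.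
rewrite re_eval_segment.
have E : (fun x : R * (weak_star V * weak_star V) =>
    re_eval v (segment_point x.1 x.2.1 x.2.2)) =
    (fun x => x.1 * re_eval v x.2.1 + (1 - x.1) * re_eval v x.2.2).
  by apply/funext => x; rewrite re_eval_segment.
suff : (fun x : R * (weak_star V * weak_star V) =>
    x.1 * re_eval v x.2.1 + (1 - x.1) * re_eval v x.2.2) @ p -->
    p.1 * re_eval v p.2.1 + (1 - p.1) * re_eval v p.2.2 by rewrite -E.
have c1 : x.1 @[x --> p] --> p.1 by exact: cvg_fst.
have c2 : re_eval v x.2.1 @[x --> p] --> re_eval v p.2.1.
  apply: (@continuous_comp _ _ _ 
    (fun x : R * (weak_star V * weak_star V) => x.2.1) (re_eval v) p).
    apply: (@continuous_comp _ _ _ snd fst p); first exact: cvg_snd.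
    exact: cvg_fst.
  exact: continuous_re_eval.
have c3 : re_eval v x.2.2 @[x --> p] --> re_eval v p.2.2.
  apply: (@continuous_comp _ _ _ 
    (fun x : R * (weak_star V * weak_star V) => x.2.2) (re_eval v) p).
    by apply: (@continuous_comp _ _ _ snd snd p); exact: cvg_snd.
  exact: continuous_re_eval.
by apply: cvgD; apply: cvgM => //; apply: cvgB => //; exact: cvg_cst.
Qed.

(** The point h is the barycenter with weights a and b. The identity is left multiplied by a + b so
    that it also covers a = b = 0. *)
Lemma real_convex_weighted C (a b : R) f g :
  real_convex C -> 0 <= a -> 0 <= b -> C f -> C g ->
  exists2 h, C h &
    forall v, (a + b) * re_eval v h = a * re_eval v f + b * re_eval v g.
Proof.
move=> cC a0 b0 Cf Cg; have [ab0|ab0] := eqVneq (a + b) 0.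
  have [-> ->] : a = 0 /\ b = 0 by split; lra.
  by exists f => // v; rewrite addr0 !mul0r addr0.
have ab : 0 < a + b by rewrite lt_neqAle eq_sym ab0 addr_ge0.
exists (segment_point (a / (a + b)) f g).
  apply: cC => //; first by rewrite divr_ge0// ltW.
  by rewrite ler_pdivrMr// mul1r lerDl.
by move=> v; rewrite re_eval_segment; field.
Qed.

(** A combination of two join points is regrouped: the two points of C, with weights t s and (1 - t)
    s', merge into one point of C, and likewise in D. *)
Lemma real_convex_join C D :
  real_convex C -> real_convex D -> real_convex (join_set C D).
Proof.
move=> cC cD t _ _ t0 t1 [[s [f g]] [/= s01 [Cf Dg]] <-]
  [[s' [f' g']] [/= s01' [Cf' Dg']] <-].
move: s01 s01'; rewrite !in_itv /= => /andP[s0 s1] /andP[s0' s1'].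
have u0 : 0 <= 1 - t by rewrite subr_ge0.
have r0 : 0 <= 1 - s by rewrite subr_ge0.
have r0' : 0 <= 1 - s' by rewrite subr_ge0.
have [f'' Cf'' fE] :=
  real_convex_weighted cC (mulr_ge0 t0 s0) (mulr_ge0 u0 s0') Cf Cf'.
have [g'' Dg'' gE] :=
  real_convex_weighted cD (mulr_ge0 t0 r0) (mulr_ge0 u0 r0') Dg Dg'.
exists (t * s + (1 - t) * s', (f'', g'')).
  split=> //=; rewrite in_itv /=; apply/andP; split; nra.
apply: re_eval_inj => v; rewrite /= !re_eval_segment fE.
have -> : 1 - (t * s + (1 - t) * s') = t * (1 - s) + (1 - t) * (1 - s') by ring.
by rewrite gE; ring.
Qed.

(** At an end of the segment f would lie in C or in D; in its interior extremality makes both ends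
    equal to f. *)
Lemma join_avoids_extreme f C D : extreme_points B f -> C `<=` B -> D `<=` B ->
  ~ C f -> ~ D f -> ~ join_set C D f.
Proof.
move=> fE CB DB Cf Df [[t [g h]] [/= t01 [Cg Dh]] fgh].
move: t01; rewrite in_itv /= => /andP[].
rewrite le_eqVlt => /predU1P[t0|t0].
  by rewrite -t0 segment_point0 in fgh; rewrite fgh in Dh.
rewrite le_eqVlt => /predU1P[t1|t1].
  by rewrite t1 segment_point1 in fgh; rewrite fgh in Cg.
have [gf _] := extreme_pointsP fE t0 t1 (CB _ Cg) (DB _ Dh) (esym fgh).
by rewrite gf in Cg.
Qed.

(* If f avoids the closure of A, finitely many weak* closed convex subsets of
   the ball avoiding f cover A; as f is extreme, it also avoids the convex hull
   of their union, which is weak* compact. *)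
Lemma milman A f : B `<=` weak_star_closed_convex_hull A -> A `<=` B ->
  extreme_points B f -> wclosure A f.
Proof.
move=> BA AB fE; apply: contrapT => nAf.
have [s [e e0 sA]] : exists (s : seq V), exists2 e : R, 0 < e &
    forall g, A g -> exists2 v, v \in s & re_eval v g <= re_eval v f - e.
  have : exists2 U, nbhs (f : weak_star V) U & forall g, A g -> ~ U g.
    apply: contrapT => nU; apply: nAf => U fU; apply: contrapT => AU.
    by apply: nU; exists U => // g Ag Ug; apply: AU; exists g.
  move=> [U /weak_star_nbhsP[s [e e0 sU]] AU].
  (* Adding the opposite vectors turns the two-sided bounds of a basic neighborhood into one-sided
     ones, each of which cuts out a half-space. *)
  exists (s ++ map -%R s), e => // g Ag; apply: contrapT => nv.
  apply: (AU g Ag).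
  apply: sU => v vs; apply/ltr_normlP; rewrite opprB; split.
    rewrite ltNge; apply/negP => ge; apply: nv; exists (- v).
      by rewrite mem_cat map_f ?orbT.
    by rewrite /re_eval !linearN !re_partN; rewrite /re_eval in ge; lra.
  rewrite ltNge; apply/negP => ge; apply: nv; exists v.
    by rewrite mem_cat vs.
  lra.
suff [D [DB cD rD Df AD]] : exists D, [/\ D `<=` B, wcompact D, real_convex D,
    ~ D f &
    forall g v, B g -> v \in s -> re_eval v g <= re_eval v f - e -> D g].
  have clD : wclosed D := compact_closed (@hausdorff_weak_star R k V) cD.
  apply: Df; apply: (@closed_convex_hull_sub A) => //.
    by move=> g Ag; have [v vs vg] := sA _ Ag; apply: (AD g v) => //; exact: AB.
  by apply: BA; case: fE.
(* The slice C of the ball cut out by u is joined to the set D obtained for s. The cases where one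
   of them is empty are separate, because the join is then empty. *)
elim: s {sA} => [|u s [D [DB cD rD Df AD]]].
  by exists set0; split=> //; exact: compact0.
pose C := B `&` [set g | re_eval u g <= re_eval u f - e].
have CB : C `<=` B by move=> g [].
have cC : wcompact C.
  apply: compact_of_closed => //; apply: closedI; first exact: closed_ball.
  exact: closed_re_eval_le.
have rC : real_convex C.
  apply: real_convexI; first exact: real_convex_ball.
  exact: real_convex_re_eval_le.
have Cf : ~ C f by move=> [_ /=]; lra.
have [[c Cc]|C0] := pselect (C !=set0); last first.
  exists D; split=> // g v Bg; rewrite inE => /predU1P[->|vs] vg.
    by exfalso; apply: C0; exists g.
  exact: (AD g v).
have [[d Dd]|D0] := pselect (D !=set0); last first.
  exists C; split=> // g v Bg; rewrite inE => /predU1P[->|vs] vg.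
    by split.
  by exfalso; apply: D0; exists g; apply: (AD g v).
exists (join_set C D); split.
- move=> _ [[t [g h]] [/= + [Cg Dh]] <-]; rewrite in_itv /= => /andP[t0 t1].
  by apply: real_convex_ball => //; [exact: CB|exact: DB].
- exact: compact_join.
- exact: real_convex_join.
- exact: join_avoids_extreme.
- move=> g v Bg; rewrite inE => /predU1P[->|vs] vg.
    exists (1, (g, d)); last by rewrite /= segment_point1.
    by split=> //=; rewrite in_itv /= ler01 lexx.
  exists (0, (c, g)); last by rewrite /= segment_point0.
  split=> /=; first by rewrite in_itv /= ler01 lexx.
  by split=> //; apply: (AD g v).
Qed.

(** The net is indexed by the neighborhoods of f under reverse inclusion, with a chosen point of A
    in each. *)
Lemma net_of_closure A f :
  wclosure A f ->
  exists (I : Type) (le : I -> I -> Prop) (u : I -> dual V),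
    [/\ directed le, forall i, A (u i) &
      (u : I -> weak_star V) @ tails le --> (f : weak_star V)].
Proof.
move=> Af; pose I := {U : set (weak_star V) | nbhs (f : weak_star V) U}.
have ex (i : I) : exists g, A g /\ sval i g.
  by have [g gAU] := Af _ (svalP i); exists g.
have [u uP] := choice ex.
pose le (i j : I) := sval j `<=` sval i.
have i0 : I by exists setT; exact: filterT.
exists I, le, u; split.
- split=> [|i|i j l ij jl|i j]; first by constructor.
  - exact: subset_refl.
  - exact: subset_trans jl ij.
  have Uij : nbhs (f : weak_star V) (sval i `&` sval j).
    exact: filterI (svalP i) (svalP j).
  by exists (exist _ _ Uij) => [g []|g []].
- by move=> i; case: (uP i).
- move=> U fU; exists (exist _ _ fU) => // j ij; apply: ij.
  by case: (uP j).
Qed.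

End separation_and_milman.

(** * Hahn-Banach *)

Section norming_functional.
Context {R : realType} {k : field_kind}.
Local Notation K := (scalar_field R k).
Local Notation re_part := (@re_part R k).
Local Notation of_real := (@of_real R k).
Variable V : normedModType K.
Implicit Types (p q : V -> R) (x y : V).

(** Homogeneity is asked only as an inequality, which is easier to check for infima; [sublinearZ]
    recovers equality by rescaling with the inverse. *)
Definition sublinear p :=
  (forall x y, p (x + y) <= p x + p y) /\
  (forall (r : R) x, 0 <= r -> p (of_real r *: x) <= r * p x).

Lemma sublinear0 p : sublinear p -> p 0 = 0.
Proof.
move=> [pD pZ]; have := pZ 0 0 (lexx _); have := pD 0 0.
by rewrite scaler0 addr0 mul0r => h1 h2; apply/eqP; rewrite eq_le h2; lra.
Qed.

Lemma sublinearZ p (r : R) x :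
  sublinear p -> 0 <= r -> p (of_real r *: x) = r * p x.
Proof.
move=> sp r0; have [pD pZ] := sp; have [->|rn0] := eqVneq r 0.
  by rewrite of_real0 scale0r mul0r sublinear0.
apply/eqP; rewrite eq_le pZ//= -ler_pdivlMl ?lt_neqAle 1?eq_sym ?rn0//.
have := pZ r^-1 (of_real r *: x).
rewrite scalerA -of_realM mulVf// of_real1 scale1r.
by apply; rewrite invr_ge0.
Qed.

Lemma sublinearN_ge p x : sublinear p -> - p (- x) <= p x.
Proof. by move=> sp; have := sp.1 x (- x); rewrite subrr sublinear0//; lra. Qed.

Lemma sublinear_norm : sublinear (fun x => re_part `|x|).
Proof.
split=> [x y|r x r0].
  by rewrite -re_partD; apply: re_part_le; exact: ler_normD.
by rewrite normrZ norm_of_real re_part_of_realM ger0_norm.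
Qed.

(** The pointwise infimum is finite, being at least - p0 (- x). For subadditivity, the smaller of
    two members of the chain that are nearly optimal at x and at y is nearly optimal at both. *)
Lemma inf_sublinear_chain (A : set (V -> R)) p0 : A !=set0 ->
  (forall p, A p -> sublinear p /\ forall x, p x <= p0 x) ->
  (forall p q, A p -> A q ->
    (forall x, p x <= q x) \/ (forall x, q x <= p x)) ->
  exists m, sublinear m /\ forall p, A p -> forall x, m x <= p x.
Proof.
move=> [a Aa] AP Achain; pose S x := [set p x | p in A].
have lbS x : has_lbound (S x).
  exists (- p0 (- x)) => _ [p Ap <-]; have [sp pp0] := AP _ Ap.
  by rewrite (le_trans _ (sublinearN_ge x sp))// lerN2.
have infS x : has_inf (S x) by split=> //; exists (a x), a.
pose m x := inf (S x).
have m_le p x : A p -> m x <= p x by move=> Ap; apply: ge_inf => //; exists p.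
exists m; split=> [|p Ap x]; last exact: m_le.
split=> [x y|r x].
  apply/ler_addgt0Pr => e e0; have e2 : 0 < e / 2 by rewrite divr_gt0.
  have [_ [p Ap <-] pm] := inf_adherent e2 (infS x).
  have [_ [q Aq <-] qm] := inf_adherent e2 (infS y).
  rewrite -/(m x) in pm; rewrite -/(m y) in qm.
  have [pq|qp] := Achain _ _ Ap Aq.
    have := m_le p (x + y) Ap; have [[pD _] _] := AP _ Ap.
    by have := pD x y; have := pq y; lra.
  have := m_le q (x + y) Aq; have [[qD _] _] := AP _ Aq.
  by have := qD x y; have := qp x; lra.
rewrite le_eqVlt => /predU1P[<-|r0].
  rewrite of_real0 scale0r mul0r (le_trans (m_le _ _ Aa))//.
  by rewrite sublinear0//; case: (AP _ Aa).
rewrite -ler_pdivrMl//; apply: lb_le_inf; first by exists (a x), a.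
move=> _ [p Ap <-]; have [[_ pZ] _] := AP _ Ap.
rewrite ler_pdivrMl// (le_trans (m_le _ _ Ap))//; apply: pZ; exact: ltW.
Qed.

Lemma minimal_sublinear p0 : sublinear p0 ->
  exists p, [/\ sublinear p, forall x, p x <= p0 x &
    forall q, sublinear q -> (forall x, q x <= p x) -> forall x, p x <= q x].
Proof.
move=> sp0; pose T := {p : V -> R | sublinear p /\ forall x, p x <= p0 x}.
(* The order is reversed, so that Zorn's maximal element is a minimal functional. *)
pose le (p q : T) := `[< forall x, sval q x <= sval p x >].
have [| | | |[p [sp pp0]] pmin] := @Zorn T le.
- by move=> p; apply/asboolP.
- move=> p q r /asboolP pq /asboolP qr; apply/asboolP => x.
  exact: le_trans (qr x) (pq x).
- move=> [p sp] [q sq] /asboolP pq /asboolP qp; apply: eq_exist.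
  by apply/funext => x; apply/eqP; rewrite eq_le qp pq.
- move=> A totA; have [[a Aa]|A0] := pselect (A !=set0); last first.
    exists (exist _ p0 (conj sp0 (fun=> lexx _))) => p Ap.
    by exfalso; apply: A0; exists p.
  have [|_ [s _ <-]|_ _ [s As <-] [t At <-]|m [sm mA]] :=
      @inf_sublinear_chain [set sval s | s in A] p0.
  + by exists (sval a), a.
  + exact: (svalP s).
  + by have [/asboolP|/asboolP] := totA _ _ As At; [right|left].
  have mp0 x : m x <= p0 x.
    by rewrite (le_trans (mA (sval a) _ _))//; [exists a|case: (svalP a)].
  exists (exist _ m (conj sm mp0)) => s As; apply/asboolP => x.
  by apply: mA; exists s.
exists p; split=> // q sq qp x.
have qp0 y : q y <= p0 y by exact: le_trans (qp y) (pp0 y).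
have le_pq : le (exist _ p (conj sp pp0)) (exist _ q (conj sq qp0)).
  exact/asboolP.
by have /(congr1 sval) /= -> := pmin _ le_pq.
Qed.

(* The function x |-> inf_(t >= 0) p (x + t x0) - t p x0. *)
Lemma sublinear_lowering p x0 : sublinear p ->
  exists q, [/\ sublinear q, forall x, q x <= p x & q (- x0) <= - p x0].
Proof.
move=> sp; have [pD pZ] := sp.
pose S x := [set p (x + of_real t *: x0) - t * p x0 | t in [set t | 0 <= t]].
have S0 x : S x !=set0 by eexists; exists 0 => /=.
have lbS x : has_lbound (S x).
  exists (- p (- x)) => _ [t /= t0 <-].
  have := pD (x + of_real t *: x0) (- x).
  by rewrite addrAC subrr add0r sublinearZ//; lra.
pose q x := inf (S x).
have q_le x t : 0 <= t -> q x <= p (x + of_real t *: x0) - t * p x0.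
  by move=> t0; apply: ge_inf => //; exists t.
have infS x : has_inf (S x) by split.
exists q; split; [split=> [x y|r x]| |].
- apply/ler_addgt0Pr => e e0; have e2 : 0 < e / 2 by rewrite divr_gt0.
  have [_ [t /= t0 <-] tq] := inf_adherent e2 (infS x).
  have [_ [s /= s0 <-] sq] := inf_adherent e2 (infS y).
  rewrite -/(q x) in tq; rewrite -/(q y) in sq.
  have := q_le (x + y) (t + s) (addr_ge0 t0 s0).
  rewrite of_realD scalerDl addrACA mulrDl.
  by have := pD (x + of_real t *: x0) (y + of_real s *: x0); lra.
- rewrite le_eqVlt => /predU1P[<-|r0].
    rewrite of_real0 scale0r mul0r (le_trans (q_le _ 0 _))//.
    by rewrite of_real0 scale0r addr0 mul0r subr0 sublinear0.
  rewrite -ler_pdivrMl//; apply: lb_le_inf => // _ [t /= t0 <-].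
  rewrite ler_pdivrMl// (le_trans (q_le _ (r * t) _))//.
    by rewrite mulr_ge0// ltW.
  rewrite of_realM -scalerA -scalerDr.
  by rewrite (sublinearZ _ sp (ltW r0)) mulrBr mulrA lexx.
- move=> x; rewrite (le_trans (q_le _ 0 _))//.
  by rewrite of_real0 scale0r addr0 mul0r subr0.
- rewrite (le_trans (q_le _ 1 _))//.
  by rewrite of_real1 scale1r addNr mul1r sublinear0// add0r.
Qed.

(* A minimal sublinear functional below the norm is linear, since
   [sublinear_lowering] at any point cannot lower it; starting from the norm
   lowered at x makes it norm x. *)
Lemma norming_functional x : exists2 f : dual V, unit_ball (dual V) f &
  re_eval x f = re_part `|x|.
Proof.
have [q [sq qN qx]] := sublinear_lowering x sublinear_norm.
have [p [sp pq pmin]] := minimal_sublinear sq.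
have pN y : p (- y) = - p y.
  apply/eqP; rewrite eq_le lerNl sublinearN_ge// andbT.
  (* Minimality of p gives p (- y) <= r (- y), and the lowering gives r (- y) <= - p y. *)
  have [r [sr rp ry]] := sublinear_lowering y sp.
  exact: le_trans (pmin _ sr rp (- y)) ry.
have pD : {morph p : y z / y + z}.
  move=> y z; apply/eqP; rewrite eq_le sp.1 /=.
  have := sp.1 (y + z) (- z); rewrite addrK pN; lra.
have pZ r y : p (of_real r *: y) = r * p y.
  have [r0|r0] := leP 0 r; first exact: sublinearZ.
  rewrite -[of_real r *: y]opprK pN -scaleNr -of_realN.
  rewrite sublinearZ ?mulNr ?opprK//.
  by rewrite oppr_ge0 ltW.
have p_le y : p y <= re_part `|y| by exact: le_trans (pq y) (qN y).
have [f f1 fp] := dual_of_real pD pZ p_le.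
exists f => //; rewrite /re_eval fp; apply/eqP; rewrite eq_le p_le /=.
by have := le_trans (pq (- x)) qx; rewrite pN lerN2.
Qed.

End norming_functional.

(** * Numerical radius and index *)

Section numerical_radius_theory.
Context {R : realType} {k : field_kind}.
Local Notation K := (scalar_field R k).
Local Notation re_part := (@re_part R k).
Local Notation of_real := (@of_real R k).
Variable X : normedModType K.
Local Notation L := (boundedop X X).
Implicit Types (T : L) (f g : dual X) (x : X).
Local Notation B := (unit_ball (dual X)).

Definition state f x :=
  [/\ unit_sphere (dual X) f, unit_sphere X x & f x = 1].

Lemma unit_ball_le f x : B f -> `|f x| <= `|x|.
Proof. by move=> f1; rewrite (le_trans (opnormP f x))// ler_piMl. Qed.

Lemma op_le T x : `|T x| <= `|T| * `|x|.
Proof. exact: opnormP. Qed.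

Lemma state_le T f x : state f x -> `|f (T x)| <= `|T|.
Proof.
move=> [f1 x1 _]; rewrite (le_trans (unit_ball_le (T x) _))//.
  by rewrite /unit_ball /= f1.
by rewrite (le_trans (op_le T x))// x1 mulr1.
Qed.

Let values T : set K := [set r | exists f x, [/\ unit_sphere (dual X) f,
  unit_sphere X x, f x = 1 & r = `|f (T x)|]].

Let supremums_values T : values T !=set0 -> supremums (values T) !=set0.
Proof.
move=> S0; apply: scalar_supremums => //.
  by move=> _ [f [x [_ _ _ ->]]].
by exists `|T| => _ [f [x [f1 x1 fx ->]]]; exact: state_le.
Qed.

Lemma numerical_radius_ge T f x : state f x -> `|f (T x)| <= numerical_radius T.
Proof.
move=> [f1 x1 fx]; have Sfx : values T `|f (T x)| by exists f, x.
have S0 : values T !=set0 by exists `|f (T x)|.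
rewrite /numerical_radius /supremum ifN; last exact/set0P.
by have [+ _] := xgetPex 0 (supremums_values S0); exact.
Qed.

(** The bound 0 <= M handles an empty set of values, whose supremum is the default 0. *)
Lemma numerical_radius_le T (M : K) : 0 <= M ->
  (forall f x, state f x -> `|f (T x)| <= M) -> numerical_radius T <= M.
Proof.
move=> M0 TM; rewrite /numerical_radius /supremum; case: ifPn => // /set0P S0.
have [_] := xgetPex 0 (supremums_values S0); apply => _ [f [x [f1 x1 fx ->]]].
exact: TM.
Qed.

Lemma numerical_radius_approx T (r : R) :
  0 <= r -> of_real r < numerical_radius T ->
  exists f x, state f x /\ r < re_part `|f (T x)|.
Proof.
move=> r0 rT; apply: contrapT => no.
suff : numerical_radius T <= of_real r.
  by move=> /(lt_le_trans rT); rewrite ltxx.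
apply: numerical_radius_le => [|f x fx]; first by rewrite of_real_ge0.
rewrite -(@of_real_norm R k K^o) ler_of_real leNgt; apply/negP => lt.
by apply: no; exists f, x.
Qed.

(** Dividing f by the unimodular scalar f x produces a state and leaves the modulus at T x
    unchanged. *)
Lemma numerical_radius_ge_norm1 T f x :
  unit_sphere (dual X) f -> unit_sphere X x -> `|f x| = 1 ->
  `|f (T x)| <= numerical_radius T.
Proof.
move=> f1 x1 fx; have fx0 : f x != 0 by rewrite -normr_eq0 fx oner_eq0.
have -> : `|f (T x)| = `|((f x)^-1 *: f) (T x)|.
  by rewrite boundedopZ normrZ normfV fx invr1 mul1r.
apply: numerical_radius_ge; split=> //; last first.
  by rewrite boundedopZ /GRing.scale /= mulVf.
by rewrite /unit_sphere /= normrZ normfV fx invr1 mul1r.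
Qed.

Lemma normalized_norm T : T != 0 -> `| `|T|^-1 *: T| = 1.
Proof. by move=> T0; rewrite normrZ normfV normr_id mulVf// normr_eq0. Qed.

Lemma exists_nonzero_op : (exists x : X, x != 0) -> exists T, T != 0.
Proof.
move=> [x x0]; have idb : (id : X -> X) \in is_boundedop.
  by apply/is_boundedopP; split=> //; exists 1 => y; rewrite mul1r.
exists (BoundedOp idb); apply: contra_neq x0 => idb0.
by have := congr1 (fun T : L => T x) idb0.
Qed.

Lemma infimum_set1 (a : K) : infimum 0 [set a] = a.
Proof.
rewrite /infimum ifF; last by apply/negbTE/set0P; exists a.
by rewrite infimums1; case: xgetP => // /(_ a) /(_ erefl).
Qed.

(** The index being 1 rules out the default value 0 of the infimum, so 1 is a true lower bound of
    the numerical radii. *)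
Lemma numerical_index1_ge T : numerical_index X = 1 -> `|T| = 1 ->
  1 <= numerical_radius T.
Proof.
have ne01 : (0 : K) = 1 -> False by move=> /esym/eqP; rewrite oner_eq0.
move=> + T1; rewrite /numerical_index /infimum.
case: ifPn => [_ /ne01//|_]; case: xgetP => [y _ [y_lb _] <-|_ /ne01//].
by apply: y_lb; exists T.
Qed.

Lemma numerical_index_eq1 : (exists x : X, x != 0) ->
  (forall T, `|T| = 1 -> numerical_radius T = 1) -> numerical_index X = 1.
Proof.
move=> /exists_nonzero_op[T T0] r1; rewrite /numerical_index.
rewrite (_ : [set _ | _ in _] = [set 1]) ?infimum_set1//.
apply/seteqP; split=> [_ [S S1 <-]|_ ->]; first exact: r1.
exists (`|T|^-1 *: T); first exact: normalized_norm.
by apply: r1; exact: normalized_norm.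
Qed.

End numerical_radius_theory.

(** * Implications between the four characterizations *)

Section numerical_index_one.
Context {R : realType} {k : field_kind}.
Local Notation K := (scalar_field R k).
Local Notation re_part := (@re_part R k).
Local Notation of_real := (@of_real R k).
Variable X : normedModType K.
Local Notation L := (boundedop X X).
Implicit Types (T : L) (f g : dual X) (x : X) (phi : dual L).

Definition extreme_tensors : set (dual L) :=
  [set phi | exists (f : dual X) (x : X),
    [/\ extreme_points (unit_ball (dual X)) f, unit_sphere X x,
        `|f x| = 1 & phi = tensor f x]].

Lemma tensor_unit_ball f x : unit_ball (dual X) f -> unit_sphere X x ->
  unit_ball (dual L) (tensor f x).
Proof.
move=> f1 x1; apply: opnorm_le => T T1.
rewrite (le_trans (unit_ball_le (T x) f1))// (le_trans (op_le T x))//.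
by rewrite x1 mulr1.
Qed.

(* An extreme point of the face {g | g u = 1} of the dual ball on which
   Re g(T x) is maximal replaces the functional of an almost optimal state;
   u is a unimodular multiple of x. *)
Lemma extreme_tensors_norming T (e : R) :
  numerical_index X = 1 -> T != 0 -> 0 < e ->
  exists2 phi, extreme_tensors phi & re_part `|T| - e < re_eval T phi.
Proof.
move=> n1 T0 e0; set N := re_part `|T|.
have TN : `|T| = of_real N by rewrite of_real_norm.
have N0 : 0 < N by rewrite -(@ltr_of_real R k) -TN of_real0 normr_gt0.
(* This makes the threshold 1 - e / N nonnegative, as [numerical_radius_approx] demands; for larger
   e the result for N / 2 is stronger. *)
wlog Ne : e e0 / e < N.
  move=> H; have [/H|Ne] := ltP e N; first exact.
  have [||phi phiE phiT] := H (N / 2); rewrite ?divr_gt0//.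
    by rewrite ltr_pdivrMr// ltr_pMr// ltr1n.
  by exists phi => //; apply: le_lt_trans phiT; lra.
pose S := `|T|^-1 *: T.
have : of_real (1 - e / N) < numerical_radius S.
  apply: (@lt_le_trans _ _ 1).
    by rewrite -[ltRHS](@of_real1 R k) ltr_of_real gtrBl divr_gt0.
  by apply: numerical_index1_ge => //; exact: normalized_norm.
move=> /numerical_radius_approx[|f [x [[f1 x1 fx] fSx]]].
  by rewrite subr_ge0 ler_pdivrMr// mul1r ltW.
have fTx : N - e < re_part `|f (T x)|.
  have -> : f (T x) = `|T| * f (S x).
    by rewrite linearZ /GRing.scale /= mulrA divff ?mul1r// normr_eq0.
  rewrite normrM normr_id TN re_part_of_realM.
  rewrite (le_lt_trans _ (_ : N * (1 - e / N) < _))//.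
    by rewrite mulrBr mulr1 mulrC mulfVK// gt_eqF.
  by rewrite ltr_pM2l.
have [c c1 cfTx] := rotation (f (T x)).
have c0 : c != 0 by rewrite -normr_eq0 c1 oner_eq0.
(* The rotation keeps h u = f x = 1 while making h (T x) = |f (T x)| a nonnegative real, so that
   real parts can be compared. *)
pose u := c^-1 *: x; pose h : dual X := c *: f.
have hB : unit_ball (dual X) h.
  by rewrite /unit_ball /= normrZ c1 mul1r f1.
have u1 : `|u| = 1 by rewrite normrZ normfV c1 invr1 mul1r.
have hu : re_eval u h = 1.
  rewrite /re_eval boundedopZ linearZ /GRing.scale /= mulrA divff// mul1r fx.
  by rewrite -(@of_real1 R k) of_realK.
pose F := maximal_face (T x) (maximal_face u (unit_ball (dual X))).
have Fh : maximal_face u (unit_ball (dual X)) h.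
  split=> // g gB; rewrite hu (le_trans (re_eval_le _ gB))// u1.
  by rewrite -(@of_real1 R k) of_realK.
have cF : closed (maximal_face u (unit_ball (dual X)) : set (weak_star X)).
  by apply: closed_maximal_face; exact: closed_ball.
have eF := extreme_maximal_face u (@extreme_subset_ball R k X).
have [|||g [[gB gu] gTx] gE] := @extreme_point_in R k X F.
- by apply: maximal_face_nonempty; [exists h|exact: compact_of_closed eF.1 cF].
- exact: closed_maximal_face.
- exact: extreme_maximal_face.
exists (tensor g x); last first.
  apply: (lt_le_trans fTx); rewrite -cfTx.
  exact: gTx _ Fh.
exists g, x; split=> //.
have gux : `|g u| = `|g x| by rewrite linearZ normrZ normfV c1 invr1 mul1r.
apply/eqP; rewrite eq_le; apply/andP; split.
  by rewrite -x1; exact: unit_ball_le.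
rewrite -gux -(@of_real_norm R k K^o) -(@of_real1 R k) ler_of_real -hu.
by rewrite (le_trans (gu _ hB))//; exact: ler_re_part_norm.
Qed.

Lemma closed_hull_of_numerical_index1 : (exists x : X, x != 0) ->
  numerical_index X = 1 ->
  unit_ball (dual L) = weak_star_closed_convex_hull extreme_tensors.
Proof.
move=> X0 n1; have ext_ball : extreme_tensors `<=` unit_ball (dual L).
  by move=> _ [f [x [[f1 _] x1 _ ->]]]; exact: tensor_unit_ball.
have hull_ball := closed_convex_hull_sub ext_ball
  (@closed_ball R k L) (@real_convex_ball R k L).
have ext_hull :
    extreme_tensors `<=` weak_star_closed_convex_hull extreme_tensors.
  by move=> phi phiE; apply: subset_closure; apply: sub_gen_smallest.
have clH : closed
    (weak_star_closed_convex_hull extreme_tensors : set (weak_star L)).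
  exact: closed_closure.
apply/seteqP; split=> // phi phiB; apply: contrapT => phiH.
have [psi psiH] : weak_star_closed_convex_hull extreme_tensors !=set0.
  have [T T0] := exists_nonzero_op X0.
  have [psi psiE _] := extreme_tensors_norming n1 T0 ltr01.
  by exists psi; exact: ext_hull.
have [T [r [Hr rphi]]] := separation (ex_intro _ _ psiH)
  (compact_of_closed hull_ball clH) clH
  (closure_real_convex (@real_convex_hull R k L extreme_tensors)) phiH.
have T0 : T != 0.
  apply: contraTneq rphi => T0; rewrite -leNgt.
  by have := Hr _ psiH; rewrite T0 /re_eval !linear0.
(* The tolerance ‖T‖ - r is positive because r < Re phi(T) <= ‖T‖; it yields a tensor whose real
   value at T exceeds r, against the separation. *)
have [|psi' psiE] := @extreme_tensors_norming T (re_part `|T| - r) n1 T0.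
  by rewrite subr_gt0 (lt_le_trans rphi)// re_eval_le.
by rewrite subKr ltNge Hr//; exact: ext_hull.
Qed.

Lemma nets_of_closed_hull :
  unit_ball (dual L) = weak_star_closed_convex_hull extreme_tensors ->
  forall phi, extreme_points (unit_ball (dual L)) phi ->
    exists (I : Type) (le : I -> I -> Prop) (f : I -> dual X) (x : I -> X),
      [/\ directed le,
          forall i, [/\ extreme_points (unit_ball (dual X)) (f i),
                        unit_sphere X (x i) & `|f i (x i)| = 1] &
          (fun i => tensor (f i) (x i) : weak_star L)
            @ tails le --> (phi : weak_star L)].
Proof.
move=> BE phi phiE.
have [|I [le [u [dle uA uphi]]]] := @net_of_closure R k L extreme_tensors phi.
  apply: milman phiE; first by rewrite BE.
  by move=> _ [f [x [[f1 _] x1 _ ->]]]; exact: tensor_unit_ball.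
have [f fP] := choice uA; have [x fxP] := choice fP.
exists I, le, f, x; split=> // [i|]; first by have [] := fxP i.
rewrite (_ : (fun i => _) = u)//; apply/funext => i.
by have [] := fxP i.
Qed.

Lemma numerical_index1_of_nets : (exists x : X, x != 0) ->
  (forall phi, extreme_points (unit_ball (dual L)) phi ->
    exists (I : Type) (le : I -> I -> Prop) (f : I -> dual X) (x : I -> X),
      [/\ directed le,
          forall i, [/\ unit_sphere (dual X) (f i),
                        unit_sphere X (x i) & `|f i (x i)| = 1] &
          (fun i => tensor (f i) (x i) : weak_star L)
            @ tails le --> (phi : weak_star L)]) ->
  numerical_index X = 1.
Proof.
move=> X0 nets; apply: numerical_index_eq1 => // T T1; apply/eqP.
rewrite eq_le; apply/andP; split.
  by apply: numerical_radius_le => // f x fx; rewrite -T1; exact: state_le.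
have [psi psiB psiT] := norming_functional T.
(* Since [psi] attains ‖T‖, every point of this face does, in particular an extreme one. *)
pose F := maximal_face T (unit_ball (dual L)).
have [|||phi [phiB phiT] phiE] := @extreme_point_in R k L F.
- apply: maximal_face_nonempty; first by exists psi.
  exact: compact_unit_ball.
- by apply: closed_maximal_face; exact: closed_ball.
- by apply: extreme_maximal_face; exact: extreme_subset_ball.
have [I [le [f [x [dle fxP fx_phi]]]]] := nets _ phiE.
have TF : ProperFilter (tails le) := tails_proper_filter dle.
have w_ge i : `|f i (T (x i))| <= numerical_radius T.
  by have [? ? ?] := fxP i; exact: numerical_radius_ge_norm1.
have [[i0] _ _ _] := dle.
have w0 : 0 <= numerical_radius T := le_trans (normr_ge0 _) (w_ge i0).
have := cvg_comp _ _ fx_phi (@continuous_re_eval R k L T phi).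
move=> /cvgr_to_le le_lim.
have H : re_eval T phi <= re_part (numerical_radius T).
  apply: le_lim; exists i0 => // i _.
  by apply: (@re_part_le_of_real R k); rewrite ge0_of_real// w_ge.
rewrite -(ge0_of_real w0) -(@of_real1 R k) ler_of_real (le_trans _ H)//.
rewrite (le_trans _ (phiT _ psiB))// psiT T1.
by rewrite -(@of_real1 R k) of_realK.
Qed.

End numerical_index_one.
Theorem theorem2p10 (R : realType) (k : field_kind)
    (X : completeNormedModType (scalar_field R k)) (X_neq0 : exists x : X, x != 0) :
  [<->
    numerical_index X = 1;
    unit_ball (dual (boundedop X X)) =
      weak_star_closed_convex_hull
        [set phi | exists (f : dual X) (x : X),
          [/\ extreme_points (unit_ball (dual X)) f, unit_sphere X x,
              `|f x| = 1 & phi = tensor f x]];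
    forall phi, extreme_points (unit_ball (dual (boundedop X X))) phi ->
      exists (I : Type) (le : I -> I -> Prop) (f : I -> dual X) (x : I -> X),
        [/\ directed le,
            forall i, [/\ extreme_points (unit_ball (dual X)) (f i),
                          unit_sphere X (x i) & `|f i (x i)| = 1] &
            (fun i => tensor (f i) (x i) : weak_star (boundedop X X))
              @ tails le --> (phi : weak_star (boundedop X X))];
    forall phi, extreme_points (unit_ball (dual (boundedop X X))) phi ->
      exists (I : Type) (le : I -> I -> Prop) (f : I -> dual X) (x : I -> X),
        [/\ directed le,
            forall i, [/\ unit_sphere (dual X) (f i),
                          unit_sphere X (x i) & `|f i (x i)| = 1] &
            (fun i => tensor (f i) (x i) : weak_star (boundedop X X))
              @ tails le --> (phi : weak_star (boundedop X X))]
  ].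
Proof.
tfae.
- exact: closed_hull_of_numerical_index1.
- exact: nets_of_closed_hull.
- move=> nets phi /nets[I [le [f [x [dle fxP fx_phi]]]]].
  exists I, le, f, x; split=> // i; have [[f1 _] x1 fx] := fxP i; split=> //.
  (* An extreme point is only known to lie in the ball; |f x| = 1 at a unit vector forces its norm
     up to 1. *)
  apply/eqP; rewrite eq_le [_ <= 1]f1 /= -fx.
  by rewrite (le_trans (opnormP _ _))// x1 mulr1.
- exact: numerical_index1_of_nets.
Qed.
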